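(* Let $X$ be a $d$-dimensional $\lambda$-two-sided link expander, and let $\ell_1,\ell_2\ge0$ be integers with $\ell_1+\ell_2+1\le d$. Let $C^{\ell_1,\ell_2}$ be the bipartite operator of the $(\ell_1,\ell_2)$-complement walk. Then $$\lambda(C^{\ell_1,\ell_2})\le(\ell_1+1)(\ell_2+1)\lambda.$$
   Context: **Weighted simplicial complexes.** $X(k)$ denotes the faces of size $k+1$ of a $d$-dimensional complex $X$ (with $X(-1)=\{\emptyset\}$), weighted by a distribution on $X(d)$: choose a $d$-face, then a uniform chain of subfaces, which induces measures on each $X(k)$. The link of $s$ is $X_s=\{u\setminus s:s\subseteq u\in X\}$, with $\Pr_{X_s}[u]=\Pr[u\cup s\mid s]$. **Link expansion.** $X$ is a $\lambda$-two-sided link expander if for every $-1\le k\le d-2$ and $s\in X(k)$, the random-walk operator of the underlying graph of $X_s$ (vertices $X_s(0)$, edges $X_s(1)$, with link measures) has all eigenvalues except the top one in $[-\lambda,\lambda]$. **Complement walk.** The $(\ell_1,\ell_2)$-complement walk is the bipartite graph with $L=X(\ell_1)$, $R=X(\ell_2)$ and edges $(s,t)$ with $s\sqcup t\in X(\ell_1+\ell_2+1)$. An edge is chosen by choosing $u\in X(\ell_1+\ell_2+1)$ by the measure and then a uniformly random $s\subseteq u$ of size $\ell_1+1$, with $t=u\setminus s$. **Bipartite expansion.** For a bipartite graph with edge distribution, $L,R$ carry the marginal measures and $Bf(v)=\mathbb E_{w\sim v}f(w)$. Define $\lambda(B)=\sup\{\langle Bf,g\rangle:\|f\|=\|g\|=1,\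 f\perp\text{constants}\}$. *)

(* Defs.v *)
From HB Require Import structures.
From mathcomp Require Import all_boot all_order all_algebra.
Set Implicit Arguments. Unset Strict Implicit. Unset Printing Implicit Defensive.
Import Order.TTheory GRing.Theory Num.Theory.
Local Open Scope ring_scope.

Section WeightedComplex.
Variables (R : rcfType) (V : finType).

(* A d-dimensional weighted (pure) complex on vertex set V is given by a
   probability distribution w on the d-faces (sets of size d+1); the complex
   consists of all subsets of the d-faces of positive weight. *)
Definition weighted_complex (d : nat) (w : {set V} -> R) : Prop :=
  [/\ forall t, 0 <= w t,
      forall t, w t != 0 -> #|t| = d.+1
    & \sum_(t : {set V}) w t = 1].

Definition wt (w : {set V} -> R) (s : {set V}) : R :=
  \sum_(t : {set V} | s \subset t) w t.

(* measure on X(k) induced by w (choose a d-face, then a uniform chain):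
   Pr[s] = wt(s) / C(d+1, k+1) for |s| = k+1. *)
Definition prk (d : nat) (w : {set V} -> R) (k : nat) (s : {set V}) : R :=
  if #|s| == k.+1 then wt w s / ('C(d.+1, k.+1))%:R else 0.

(* distribution on the top faces of the link X_s (a (d-|s|)-dim. complex):
   Pr_{X_s}[u] = Pr[u \cup s | s]. *)
Definition linkw (w : {set V} -> R) (s : {set V}) (u : {set V}) : R :=
  if [disjoint u & s] then w (u :|: s) / wt w s else 0.

Definition vtx (d : nat) (w : {set V} -> R) : {set V} :=
  [set x | 0 < prk d w 0 [set x]].

(* random-walk operator of the underlying graph (edges X(1) with their
   measure): go from x along an edge chosen conditioned on containing x. *)
Definition rw (d : nat) (w : {set V} -> R) (x y : V) : R :=
  if x != y then
    prk d w 1 [set x; y] / \sum_(z : V | z != x) prk d w 1 [set x; z]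
  else 0.

Definition rw_mx (d : nat) (w : {set V} -> R) : 'M[R]_#|vtx d w| :=
  \matrix_(i, j) rw d w (enum_val i) (enum_val j).

Definition eig_but_top_in (n : nat) (M : 'M[R]_n) (lam : R) : Prop :=
  exists (a : R) (q : {poly R}),
    [/\ char_poly M = ('X - a%:P) * q,
        forall r, root (char_poly M) r -> r <= a
      & forall r, root q r -> - lam <= r <= lam].

(* lambda-two-sided link expander: for all -1 <= k <= d-2 and s in X(k),
   i.e. faces s with |s| = k+1 <= d-1; the link X_s has dimension d-|s|. *)
Definition link_expander (d : nat) (w : {set V} -> R) (lam : R) : Prop :=
  forall s : {set V}, 0 < wt w s -> (#|s| < d)%N ->
    eig_but_top_in (rw_mx (d - #|s|) (linkw w s)) lam.

Definition cw_edge (d : nat) (w : {set V} -> R) (l1 l2 : nat)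
    (s t : {set V}) : R :=
  if [&& #|s| == l1.+1, #|t| == l2.+1 & [disjoint s & t]] then
    prk d w (l1 + l2).+1 (s :|: t) / ('C((l1 + l2).+2, l1.+1))%:R
  else 0.

(* bipartite graph with edge distribution P on L x R (both sides encoded as
   {set V}; P vanishes outside L x R) *)
Definition margL (P : {set V} -> {set V} -> R) s := \sum_(t : {set V}) P s t.
Definition margR (P : {set V} -> {set V} -> R) t := \sum_(s : {set V}) P s t.
Definition bipB (P : {set V} -> {set V} -> R) (f : {set V} -> R) s :=
  (\sum_(t : {set V}) P s t * f t) / margL P s.

(* lambda(B) <= c, i.e. sup{<Bf,g> : ||f|| = ||g|| = 1, f _|_ constants} <= c *)
Definition bip_lambda_le (P : {set V} -> {set V} -> R) (c : R) : Prop :=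
  forall f g : {set V} -> R,
    \sum_(t : {set V}) margR P t * f t = 0 ->
    \sum_(t : {set V}) margR P t * f t ^+ 2 = 1 ->
    \sum_(s : {set V}) margL P s * g s ^+ 2 = 1 ->
    \sum_(s : {set V}) margL P s * bipB P f s * g s <= c.

End WeightedComplex.

(* Main.v *)
Require Import Defs.
From HB Require Import structures.
From mathcomp Require Import all_boot all_order all_algebra.
From mathcomp Require Import complex ring lra zify.
Import Order.TTheory GRing.Theory Num.Theory.
Local Open Scope ring_scope.

(* Bounds of the form <Cf, g> <= <f><g> + c (|f|^2 + |g|^2) / 2, where < > is
   the mean, add up over links.  Sampling a pair (s, t) of the (a+1, b)
   complement walk, first reveal a random vertex v of s: given v, the pair
   (s - v, t) follows the (a, b) walk in the link of v, and the product of
   conditional means left over is a correlation of the (1, b) walk between f and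
   the function v |-> E[g | v].  Hence c(a+1, b) <= c(a, b) + c(1, b), and since
   the walk is symmetric in (a, b) everything reduces to c(1, 1), the underlying
   graph of a link, where the spectral theorem gives lam.  Faces are replaced by
   sequences of distinct vertices (a uniformly ordered random top face), which
   makes revealing a vertex a mere change of prefix. *)

Set Implicit Arguments. Unset Strict Implicit. Unset Printing Implicit Defensive.

(** * Real symmetric matrices and the two-sided eigenvalue bound *)

Section RealSymmetric.
Local Open Scope sesquilinear_scope.

Lemma char_poly_similar (F : fieldType) n (P A : 'M[F]_n) :
  P \in unitmx -> char_poly (invmx P *m A *m P) = char_poly A.
Proof.
move=> Pu; pose Q := map_mx polyC P.
have VQ : map_mx polyC (invmx P) *m Q = 1%:M by rewrite -map_mxM mulVmx// map_mx1.
rewrite /char_poly /char_poly_mx !map_mxM /=.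
have -> : 'X%:M - map_mx polyC (invmx P) *m map_mx polyC A *m Q =
    map_mx polyC (invmx P) *m ('X%:M - map_mx polyC A) *m Q.
  by rewrite mulmxBr mulmxBl scalar_mxC -(mulmxA 'X%:M) VQ mulmx1.
by rewrite !det_mulmx mulrAC -det_mulmx VQ det1 mul1r.
Qed.

(** Over [R[i]] the matrix becomes Hermitian, hence unitarily diagonalizable with real eigenvalues.
    The factorization of the characteristic polynomial then descends to [R] because the embedding of
    coefficients is injective. *)
Lemma real_symmetric_spectral (R : rcfType) n (S : 'M[R]_n) : S^T = S ->
  exists (r : 'I_n -> R) (U : 'M[R[i]]_n),
    [/\ char_poly S = \prod_i ('X - (r i)%:P), U \is unitarymx
      & map_mx (real_complex R) S =
        U ^t* *m diag_mx (\row_i (real_complex R (r i))) *m U].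
Proof.
move=> symS; pose A := map_mx (real_complex R) S.
have symA : A \is symmetricmx.
  by apply/is_hermitianmxP; rewrite scale1r map_mx_id // /A map_trmx symS.
have realA : A \is a mxOver Num.real.
  by apply/mxOverP => i j; rewrite mxE; apply/complex_realP; exists (S i j).
have hermA := realsym_hermsym symA realA.
have /orthomx_spectralP eqA := hermitian_normalmx hermA.
have /mxOverP realD := hermitian_spectral_diag_real hermA.
set U := spectralmx A in eqA; set D := spectral_diag A in eqA realD.
have eqD : D = \row_i (real_complex R (complex.Re (D 0 i))).
  by apply/rowP => i; rewrite mxE RRe_real // realD.
exists (fun i => complex.Re (D 0 i)), U; split; last 2 first.
- exact: spectral_unitarymx.
- by rewrite -eqD -[LHS]/A eqA invmx_unitary // spectral_unitarymx.
apply: (map_poly_inj (real_complex R)); rewrite map_char_poly -/A eqA.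
rewrite char_poly_similar ?spectral_unit // char_poly_trig; last first.
  exact/diag_mx_is_trig.
rewrite rmorph_prod; apply: eq_bigr => i _.
rewrite rmorphB /= map_polyX map_polyC mxE eqxx mulr1n.
by congr (_ - _%:P); rewrite -[LHS]RRe_real ?realD.
Qed.


(** Cancelling one factor ['X - a] leaves [q] as the product over all indices but one, so an
    eigenvalue [a] of higher multiplicity is exempted only once. *)
Lemma eig_but_top_prod (R : rcfType) n (M : 'M[R]_n) lam (r : 'I_n -> R) :
  char_poly M = \prod_i ('X - (r i)%:P) -> eig_but_top_in M lam ->
  exists i0, forall i, i != i0 -> - lam <= r i <= lam.
Proof.
move=> chr [a [q [chM _ qlam]]].
have [i0 ri0] : exists i0, r i0 = a.
  have : root (char_poly M) a by rewrite chM rootM root_XsubC eqxx.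
  rewrite chr rootE horner_prod => /prodf_eq0[i _].
  by rewrite !hornerE subr_eq0 => /eqP ai; exists i.
have qE : q = \prod_(i | i != i0) ('X - (r i)%:P).
  apply: (mulfI (negbT (polyXsubC_eq0 a))).
  by rewrite -chM chr (bigD1 i0) //= ri0.
exists i0 => i ii0; apply: qlam; rewrite qE rootE horner_prod.
by apply/prodf_eq0; exists i => //; rewrite !hornerE subrr.
Qed.

(* The all-but-one hypothesis is matched with the spectral decomposition by
   cancelling the factor 'X - a: since lam < 1, the eigenvector v for 1 must be
   carried by the cancelled index. *)
Lemma eig_but_top_quad_bound (R : rcfType) n (S : 'M[R]_n) lam (v x : 'rV[R]_n) :
  S^T = S -> eig_but_top_in S lam -> lam < 1 -> v *m S = v -> v != 0 ->
  x *m v^T = 0 ->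
  `|(x *m S *m x^T) 0 0| <= lam * (x *m x^T) 0 0.
Proof.
move=> symS eigS lam1 vS v0 xv.
have [r [U [chr Uu eqS]]] := real_symmetric_spectral symS.
have [i0 rlam] := eig_but_top_prod chr eigS.
(* Coordinates in the orthonormal eigenbasis given by the rows of [U]; they are complex, hence the
   squared moduli [m i] below. *)
pose coord (z : 'rV[R]_n) := map_mx (real_complex R) z *m U ^t*.
have coordT (z : 'rV[R]_n) : map_mx (real_complex R) z^T = U ^t* *m (coord z) ^t*.
  rewrite /coord trmx_mul map_mxM /= trmxCK mulmxA.
  rewrite -[U ^t*](invmx_unitary Uu) mulVmx ?unitarymx_unit // mul1mx.
  by apply/matrixP => i j; rewrite !mxE conj_Creal //; apply/complex_realP; eexists.
have UUt : U *m U ^t* = 1%:M by apply/unitarymxP.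
have dotE (y z : 'rV[R]_n) : real_complex R ((y *m z^T) 0 0) =
    \sum_i coord y 0 i * (coord z 0 i)^*.
  have -> : real_complex R ((y *m z^T) 0 0) = map_mx (real_complex R) (y *m z^T) 0 0.
    by rewrite [RHS]mxE.
  rewrite map_mxM coordT mulmxA -/(coord y) mxE.
  by apply: eq_bigr => i _; rewrite !mxE.
have coordS (z : 'rV[R]_n) i : coord (z *m S) 0 i = coord z 0 i * real_complex R (r i).
  rewrite /coord map_mxM eqS -!mulmxA UUt mulmx1 mulmxA -/(coord z).
  by rewrite mul_mx_diag !mxE.
pose m i := complex.Re (coord x 0 i) ^+ 2 + complex.Im (coord x 0 i) ^+ 2.
have mE i : coord x 0 i * (coord x 0 i)^* = real_complex R (m i).
  by rewrite -normCK add_Re2_Im2.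
have m_ge0 i : 0 <= m i by rewrite addr_ge0 ?sqr_ge0.
have quadE : (x *m S *m x^T) 0 0 = \sum_i r i * m i.
  apply: (@complexI R); rewrite dotE rmorph_sum; apply: eq_bigr => i _.
  by rewrite coordS mulrAC mE mulrC rmorphM.
have normE : (x *m x^T) 0 0 = \sum_i m i.
  apply: (@complexI R); rewrite dotE rmorph_sum; apply: eq_bigr => i _.
  by rewrite mE.
have cv i : i != i0 -> coord v 0 i = 0.
  move=> ii0; have := coordS v i; rewrite vS => /eqP.
  rewrite -subr_eq0 -{1}[coord v 0 i]mulr1 -mulrBr mulf_eq0 => /orP[/eqP //|].
  rewrite -(rmorph1 (real_complex R)) -rmorphB -(rmorph0 (real_complex R)).
  rewrite (inj_eq (@complexI R)) subr_eq0 => /eqP r1.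
  by have := rlam _ ii0; rewrite -r1 => /andP[_]; rewrite leNgt lam1.
(* Only [i0] contributes to the inner product of [x] and [v], so one of the two coordinates there is
   0. If it were that of [v], then [v] itself would be 0. *)
have mi0 : m i0 = 0.
  have := dotE x v; rewrite xv mxE (bigD1 i0) //= big1 => [|i ii0]; last first.
    by rewrite cv // conjC0 mulr0.
  rewrite addr0 rmorph0 => /esym/eqP; rewrite mulf_eq0 conjC_eq0 => /orP[/eqP c0|/eqP c0].
    by rewrite /m c0 /= expr0n addr0.
  case/eqP: v0; apply: (@map_mx_inj _ _ (real_complex R)); rewrite map_mx0.
  rewrite -[LHS]mulmx1 -(mulVmx (unitarymx_unit Uu)) invmx_unitary // mulmxA -/(coord v).
  have -> : coord v = 0; last by rewrite mul0mx.
  by apply/rowP => i; rewrite [RHS]mxE; have [->|/cv] := eqVneq i i0.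
rewrite quadE normE mulr_sumr (le_trans (ler_norm_sum _ _ _)) // ler_sum // => i _.
rewrite normrM (ger0_norm (m_ge0 i)).
have [->|/rlam] := eqVneq i i0; first by rewrite mi0 !mulr0.
by rewrite -ler_norml => /ler_wpM2r ->.
Qed.

(** A second eigenvalue exists, so the interval from [- lam] to [lam] is not empty. *)
Lemma eig_but_top_ge0 (R : rcfType) n (S : 'M[R]_n) lam :
  S^T = S -> eig_but_top_in S lam -> (1 < n)%N -> 0 <= lam.
Proof.
move=> symS eigS n1.
have [r [U [chr _ _]]] := real_symmetric_spectral symS.
have [i0 rlam] := eig_but_top_prod chr eigS.
have [i ii0] : exists i, i != i0.
  have /card_gt1P[i [j [_ _ ij]]] : (1 < #|'I_n|)%N by rewrite card_ord.
  by have [ii|] := eqVneq i i0; [exists j; rewrite -ii eq_sym | exists i].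
have := rlam _ ii0; lra.
Qed.

End RealSymmetric.

(** * Correlation bound for a reversible Markov chain *)

Section ReversibleChain.
Variables (R : rcfType) (n : nat) (K : 'I_n -> 'I_n -> R) (p : 'I_n -> R) (lam : R).
Hypotheses (p_gt0 : forall i, 0 < p i) (K_ge0 : forall i j, 0 <= K i j).
Hypotheses (K_sym : forall i j, K i j = K j i) (K_marg : forall i, \sum_j K i j = p i).
Hypothesis eigM : eig_but_top_in (\matrix_(i, j) (K i j / p i)) lam.

Let s i := Num.sqrt (p i).
(** Symmetrization of the transition matrix: conjugating [S] by the diagonal matrix of the [s i]
    gives [K i j / p i], so the two share their characteristic polynomial. *)
Let S : 'M[R]_n := \matrix_(i, j) (K i j / (s i * s j)).

Let s_neq0 i : s i != 0.
Proof. by rewrite gt_eqF // sqrtr_gt0. Qed.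

Let sE i : s i * s i = p i.
Proof. by rewrite -expr2 sqr_sqrtr // ltW. Qed.

Let S_sym : S^T = S.
Proof. by apply/matrixP => i j; rewrite !mxE K_sym [s i * _]mulrC. Qed.

Let eigS : eig_but_top_in S lam.
Proof.
have Dinv : diag_mx (\row_i (s i)^-1) *m diag_mx (\row_i s i) = 1%:M.
  apply/matrixP => i j; rewrite mul_mx_diag !mxE.
  by have [->|] := eqVneq i j; rewrite ?mulr1n ?mulVf // mulr0n mul0r.
have [_ Du] := mulmx1_unit Dinv.
have MS : \matrix_(i, j) (K i j / p i) =
    invmx (diag_mx (\row_i s i)) *m S *m diag_mx (\row_i s i).
  have -> : invmx (diag_mx (\row_i s i)) = diag_mx (\row_i (s i)^-1).
    by rewrite -[LHS]mul1mx -Dinv -mulmxA mulmxV // mulmx1.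
  apply/matrixP => i j; rewrite mul_mx_diag mul_diag_mx !mxE -sE.
  by field; rewrite !s_neq0.
by move: eigM; rewrite /eig_but_top_in MS char_poly_similar.
Qed.

Let vS : (\row_i s i) *m S = \row_i s i.
Proof.
apply/rowP => j; rewrite !mxE.
transitivity (\sum_i K j i / s j); last by rewrite -mulr_suml K_marg -sE mulfK.
by apply: eq_bigr => i _; rewrite !mxE K_sym; field; rewrite !s_neq0.
Qed.

Lemma reversible_chain_lam_ge0 : (1 < n)%N -> 0 <= lam.
Proof. exact: eig_but_top_ge0 S_sym eigS. Qed.

Let norm2 (h : 'I_n -> R) := \sum_i p i * h i ^+ 2.
Let form (g f : 'I_n -> R) := \sum_i \sum_j K i j * (g i * f j).

Let norm2_ge0 h : 0 <= norm2 h.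
Proof. by apply: sumr_ge0 => i _; rewrite mulr_ge0 ?sqr_ge0 // ltW. Qed.

Let sum_l (F : 'I_n -> R) : \sum_i \sum_j K i j * F i = \sum_i p i * F i.
Proof. by apply: eq_bigr => i _; rewrite -mulr_suml K_marg. Qed.

Let sum_r (F : 'I_n -> R) : \sum_i \sum_j K i j * F j = \sum_i p i * F i.
Proof.
rewrite exchange_big -sum_l /=.
by apply: eq_bigr => i _; apply: eq_bigr => j _; rewrite K_sym.
Qed.

Let sum_sqr h e : \sum_i \sum_j K i j * (h i + e * h j) ^+ 2 =
  norm2 h + e ^+ 2 * norm2 h + 2 * e * form h h.
Proof.
rewrite /norm2 -{1}sum_l -sum_r /form !mulr_sumr -!big_split /=.
apply: eq_bigr => i _; rewrite !mulr_sumr -!big_split /=.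
by apply: eq_bigr => j _; ring.
Qed.

(** The averages of [(h i + h j) ^+ 2] and [(h i - h j) ^+ 2] under [K] are nonnegative. *)
Let form_amgm h : `|form h h| <= norm2 h.
Proof.
have sqr_pos e : 0 <= \sum_i \sum_j K i j * (h i + e * h j) ^+ 2.
  by apply: sumr_ge0 => i _; apply: sumr_ge0 => j _; rewrite mulr_ge0 ?sqr_ge0.
have := sqr_pos 1; have := sqr_pos (-1); rewrite !sum_sqr ler_norml.
by move=> ? ?; apply/andP; split; lra.
Qed.

(** For [lam < 1] this is the spectral bound at the vector [s i * h i], whose orthogonality to the
    eigenvector [s] is the centering of [h]. For [1 <= lam] the trivial bound [form_amgm]
    suffices. *)
Let form_centered h : (0 < n)%N -> 0 <= lam -> \sum_i p i * h i = 0 ->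
  `|form h h| <= lam * norm2 h.
Proof.
move=> n_gt0 lam0 hc; have [lam1|lam1] := leP 1 lam.
  by rewrite (le_trans (form_amgm h)) // ler_peMl.
pose x : 'rV[R]_n := \row_i (s i * h i).
have v0 : \row_i s i != 0 :> 'rV[R]_n.
  by apply/eqP => /rowP/(_ (Ordinal n_gt0)); rewrite !mxE; apply/eqP.
have xv : x *m (\row_i s i)^T = 0.
  apply/matrixP => i j; rewrite !mxE -[RHS]hc; apply: eq_bigr => k _.
  by rewrite !mxE mulrAC sE.
have := eig_but_top_quad_bound S_sym eigS lam1 vS v0 xv.
have -> : (x *m x^T) 0 0 = norm2 h.
  by rewrite mxE; apply: eq_bigr => k _; rewrite !mxE mulrACA sE expr2.
have -> // : (x *m S *m x^T) 0 0 = form h h.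
rewrite mxE /form exchange_big /=; apply: eq_bigr => j _.
rewrite !mxE mulr_suml; apply: eq_bigr => i _; rewrite !mxE.
by field; rewrite !s_neq0.
Qed.

Lemma reversible_chain_bound (g f : 'I_n -> R) : (0 < n)%N -> 0 <= lam ->
  \sum_i \sum_j K i j * (g i * f j) <=
    (\sum_i p i * g i) * (\sum_i p i * f i) / (\sum_i p i)
    + lam / 2 * (\sum_i p i * g i ^+ 2 + \sum_i p i * f i ^+ 2).
Proof.
move=> n_gt0 lam0; set Z := \sum_i p i.
have Z_gt0 : 0 < Z.
  rewrite /Z (bigD1 (Ordinal n_gt0)) //= ltr_pwDl ?p_gt0 // sumr_ge0 // => i _.
  exact: ltW.
pose mean h := (\sum_i p i * h i) / Z.
have meanE h : \sum_i p i * h i = mean h * Z by rewrite divfK ?gt_eqF.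
have shift h e : \sum_i p i * (h i + e) = (mean h + e) * Z.
  by rewrite mulrDl -meanE mulr_sumr -big_split; apply: eq_bigr => i _ /=; ring.
(* Centering splits off the product of the means and does not increase the norms. *)
pose g0 i := g i - mean g; pose f0 i := f i - mean f.
have g0c : \sum_i p i * g0 i = 0 by rewrite shift addrN mul0r.
have f0c : \sum_i p i * f0 i = 0 by rewrite shift addrN mul0r.
have formE : form g f = form g0 f0 + mean g * mean f * Z.
  have : form g f = form g0 f0 + mean f * (\sum_i p i * g i) +
      mean g * (\sum_i p i * f i) - mean g * mean f * Z.
    rewrite -sum_l -sum_r /form !mulr_sumr -sumrN -!big_split /=.
    apply: eq_bigr => i _; rewrite -(K_marg i) !mulr_sumr -sumrN -!big_split /=.
    by apply: eq_bigr => j _; rewrite /g0 /f0; ring.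
  by rewrite !meanE => ->; ring.
have norm_le h : norm2 (fun i => h i - mean h) <= norm2 h.
  have -> : norm2 (fun i => h i - mean h) = norm2 h - mean h ^+ 2 * Z.
    have : norm2 (fun i => h i - mean h) = norm2 h - 2 * mean h * (\sum_i p i * h i)
       + mean h ^+ 2 * Z.
      rewrite /norm2 !mulr_sumr -sumrN -!big_split /=.
      by apply: eq_bigr => i _; ring.
    by rewrite meanE => ->; ring.
  by rewrite gerBl mulr_ge0 ?sqr_ge0 // ltW.
(* The spectral bound covers only the diagonal of the form. It is applied to [g0 + f0] and
   [g0 - f0], and the parallelogram law [para] recombines the norms, which yields the factor
   [lam / 2]. *)
have polar : form (fun i => g0 i + f0 i) (fun i => g0 i + f0 i)
    - form (fun i => g0 i - f0 i) (fun i => g0 i - f0 i) = 4 * form g0 f0.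
  have formC : form g0 f0 = form f0 g0.
    rewrite /form exchange_big; apply: eq_bigr => i _; apply: eq_bigr => j _ /=.
    by rewrite K_sym mulrC [g0 _ * _]mulrC mulrC.
  have -> : 4 * form g0 f0 = 2 * form g0 f0 + 2 * form f0 g0 by rewrite -formC; ring.
  rewrite /form !mulr_sumr -sumrN -!big_split /=.
  apply: eq_bigr => i _; rewrite !mulr_sumr -sumrN -!big_split /=.
  by apply: eq_bigr => j _; ring.
have para : norm2 (fun i => g0 i + f0 i) + norm2 (fun i => g0 i - f0 i) =
    2 * (norm2 g0 + norm2 f0).
  rewrite /norm2 mulrDr !mulr_sumr -!big_split /=.
  by apply: eq_bigr => i _; ring.
have /(form_centered n_gt0 lam0) : \sum_i p i * (g0 i + f0 i) = 0.
  by under eq_bigr do rewrite mulrDr; rewrite big_split /= g0c f0c addr0.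
have /(form_centered n_gt0 lam0) : \sum_i p i * (g0 i - f0 i) = 0.
  by under eq_bigr do rewrite mulrBr; rewrite sumrB /= g0c f0c subr0.
rewrite !ler_norml => /andP[lo _] /andP[_ hi].
have bound0 : form g0 f0 <= lam / 2 * (norm2 g0 + norm2 f0).
  have : 4 * form g0 f0 <= lam * (norm2 (fun i => g0 i + f0 i) + norm2 (fun i => g0 i - f0 i)).
    by rewrite -polar; lra.
  by rewrite para; lra.
rewrite -/(form g f) -/(norm2 g) -/(norm2 f) formE !meanE.
have -> : mean g * Z * (mean f * Z) / Z = mean g * mean f * Z by field; rewrite gt_eqF.
rewrite addrC lerD2l (le_trans bound0) // ler_wpM2l ?divr_ge0 //.
by rewrite lerD ?norm_le.
Qed.
End ReversibleChain.

(** * Sums over sequences of fixed length *)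

Section SeqSum.
Variables (R : realFieldType) (V : finType).

(** The recursion on the head makes revealing the first vertex a mere unfolding. *)
Fixpoint seqsum (a : nat) (F : seq V -> R) : R :=
  if a is a'.+1 then \sum_v seqsum a' (fun x => F (v :: x)) else F [::].

Lemma eq_seqsum a F G :
  (forall x, size x = a -> F x = G x) -> seqsum a F = seqsum a G.
Proof.
elim: a F G => [|a IHa] F G eqFG; first exact: eqFG.
by apply: eq_bigr => v _; apply: IHa => x sx; apply: eqFG; rewrite /= sx.
Qed.

Lemma seqsum_eq0 a F : (forall x, size x = a -> F x = 0) -> seqsum a F = 0.
Proof.
elim: a F => [|a IHa] F F0; first exact: F0.
by apply: big1 => v _; apply: IHa => x sx; apply: F0; rewrite /= sx.
Qed.

Lemma seqsum_ge0 a F : (forall x, 0 <= F x) -> 0 <= seqsum a F.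
Proof.
by elim: a F => [|a IHa] F F0 //=; apply: sumr_ge0 => v _; apply: IHa.
Qed.

Lemma seqsumD a F G : seqsum a (fun x => F x + G x) = seqsum a F + seqsum a G.
Proof.
elim: a F G => [//|a IHa] F G /=; rewrite -big_split.
by apply: eq_bigr => v _; rewrite IHa.
Qed.

Lemma seqsumZ a c F : seqsum a (fun x => c * F x) = c * seqsum a F.
Proof.
elim: a F => [//|a IHa] F /=; rewrite mulr_sumr.
by apply: eq_bigr => v _; rewrite IHa.
Qed.

Lemma seqsum_sum (I : finType) a (F : I -> seq V -> R) :
  seqsum a (fun x => \sum_i F i x) = \sum_i seqsum a (F i).
Proof.
elim: a F => [//|a IHa] F /=; rewrite exchange_big.
by apply: eq_bigr => v _; rewrite IHa.
Qed.

Lemma exchange_seqsum a b (F : seq V -> seq V -> R) :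
  seqsum a (fun x => seqsum b (F x)) = seqsum b (fun y => seqsum a (F^~ y)).
Proof.
elim: a F => [//|a IHa] F /=; rewrite seqsum_sum.
by apply: eq_bigr => v _; rewrite IHa.
Qed.

End SeqSum.

(** * Expansion bounds for exchangeable sequences *)

(* [mu] is the law of the initial segments of a random exchangeable sequence
   of length [n]; conditioning on the segment [z] plays the role of the link. *)
Section Exchangeable.
Variables (R : realFieldType) (V : finType) (n : nat) (mu : seq V -> R).
Hypothesis mu_ge0 : forall x, 0 <= mu x.
Hypothesis mu_perm : forall x y, perm_eq x y -> mu x = mu y.
Hypothesis mu_marg : forall x, (size x < n)%N -> \sum_v mu (v :: x) = mu x.

(** The unnormalized conditional expectation: [mu z] times the mean of [F] over the next [a]
    entries, given the prefix [z]. *)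
Definition seqE (z : seq V) (a : nat) (F : seq V -> R) : R :=
  seqsum a (fun x => mu (z ++ x) * F x).

(** The bound in the link of [z], multiplied by [mu z]. This scaling lets the bounds for the
    prefixes [v :: z] simply be summed over [v]. *)
Definition expand_bound (c : R) (z : seq V) (a b : nat) : Prop :=
  forall g f : seq V -> R,
    seqsum a (fun x => seqsum b (fun y => mu (z ++ x ++ y) * (g x * f y))) <=
    seqE z a g * seqE z b f / mu z
    + c / 2 * (seqE z a (fun x => g x ^+ 2) + seqE z b (fun y => f y ^+ 2)).

Lemma seqE_ge0 z a F : (forall x, 0 <= F x) -> 0 <= seqE z a F.
Proof. by move=> F0; apply: seqsum_ge0 => x; rewrite mulr_ge0. Qed.

Lemma mu_cons_cat z v x : mu (z ++ v :: x) = mu ((v :: z) ++ x).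
Proof. by apply: mu_perm; rewrite -cat1s perm_catCA. Qed.

Lemma seqES z a F : seqE z a.+1 F = \sum_v seqE (v :: z) a (fun x => F (v :: x)).
Proof.
by apply: eq_bigr => v _; apply: eq_seqsum => x _; rewrite mu_cons_cat.
Qed.

Lemma seqE_1 z a : (size z + a <= n)%N -> seqE z a (fun=> 1) = mu z.
Proof.
elim: a z => [|a IHa] z za; first by rewrite /seqE /= cats0 mulr1.
rewrite seqES -mu_marg; last lia.
by apply: eq_bigr => v _; rewrite IHa //=; lia.
Qed.

Lemma seqsum_mu_cat z a c : (size z + a <= n)%N ->
  seqsum a (fun x => mu (z ++ x) * c) = mu z * c.
Proof.
move=> za; rewrite -(seqE_1 za) mulrC -seqsumZ.
by apply: eq_seqsum => x _; rewrite mulr1 mulrC.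
Qed.

Lemma mu_cat_eq0 z x : (size z + size x <= n)%N -> mu z = 0 -> mu (z ++ x) = 0.
Proof.
elim: x z => [|v x IHx] z /= zx mz; first by rewrite cats0.
rewrite mu_cons_cat; apply: IHx => /=; first by lia.
have := mu_marg (x := z); rewrite mz => /(_ ltac:(lia)) /eqP.
by rewrite psumr_eq0 // => /allP/(_ v (mem_index_enum _))/eqP.
Qed.

Lemma seqE_eq0 z a F : (size z + a <= n)%N -> mu z = 0 -> seqE z a F = 0.
Proof.
by move=> za mz; apply: seqsum_eq0 => x sx; rewrite mu_cat_eq0 ?mul0r ?sx.
Qed.

Lemma seqE_cons z b F : (size z + b < n)%N ->
  \sum_v seqE (v :: z) b F = seqE z b F.
Proof.
move=> zb; rewrite -seqsum_sum; apply: eq_seqsum => y sy.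
by rewrite -mulr_suml mu_marg // size_cat sy.
Qed.

(** The variance of [F] around its conditional mean [m] is nonnegative; a null prefix makes both
    sides 0. *)
Lemma seqE_jensen z a F : (size z + a <= n)%N ->
  seqE z a F ^+ 2 / mu z <= seqE z a (fun x => F x ^+ 2).
Proof.
move=> za; have [mz|mz] := eqVneq (mu z) 0.
  by rewrite !seqE_eq0 // expr0n mul0r.
have mz_gt0 : 0 < mu z by rewrite lt_def mz mu_ge0.
pose m := seqE z a F / mu z.
have : 0 <= seqE z a (fun x => (F x - m) ^+ 2) by apply: seqE_ge0 => x; rewrite sqr_ge0.
have -> : seqE z a (fun x => (F x - m) ^+ 2) =
    seqE z a (fun x => F x ^+ 2) + (- 2 * m) * seqE z a F + m ^+ 2 * seqE z a (fun=> 1).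
  rewrite /seqE -!seqsumZ -!seqsumD; apply: eq_seqsum => x _; ring.
rewrite seqE_1 // => ge0; rewrite -subr_ge0; apply: le_trans ge0 _.
by rewrite le_eqVlt; apply/predU1P; left; rewrite /m; field.
Qed.

Lemma expand_boundC c z a b : expand_bound c z a b -> expand_bound c z b a.
Proof.
move=> Hab g f; have := Hab f g; rewrite exchange_seqsum.
rewrite [seqE z b g * _]mulrC [seqE z b _ + _]addrC; congr (_ <= _).
apply: eq_seqsum => x _; apply: eq_seqsum => y _.
by rewrite [f y * _]mulrC (mu_perm (y := z ++ x ++ y)) // perm_cat2l perm_catC.
Qed.

(** The empty sequence carries no information, so [g] is a constant and equality holds. *)
Lemma expand_bound0 z b : (size z + b <= n)%N -> expand_bound 0 z 0 b.
Proof.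
move=> zb g f; rewrite /= mul0r mul0r addr0 {1}/seqE /= cats0.
have -> : seqsum b (fun y => mu (z ++ y) * (g [::] * f y)) = g [::] * seqE z b f.
  by rewrite -seqsumZ; apply: eq_seqsum => y _; ring.
have [mz|mz] := eqVneq (mu z) 0; first by rewrite seqE_eq0 // !mulr0 mul0r.
by rewrite le_eqVlt; apply/predU1P; left; field.
Qed.

Lemma expand_bound_null c z a b :
  (size z + a + b <= n)%N -> mu z = 0 -> expand_bound c z a b.
Proof.
move=> zab mz g f; rewrite !seqE_eq0 ?mul0r //; try lia.
rewrite addr0 mulr0 addr0 le_eqVlt; apply/predU1P; left.
apply: seqsum_eq0 => x sx; apply: seqsum_eq0 => y sy.
by rewrite mu_cat_eq0 ?mul0r // size_cat; lia.
Qed.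

(* Reveal the first vertex v of x: the pair (rest of x, y) is an (a, b) pair
   in the link of v, and the product of the two conditional means is a
   (1, b) correlation, with h v the mean of g given v. *)
Lemma expand_boundS c c' z a b : (size z + a.+1 + b <= n)%N -> 0 <= c' ->
  (forall v, expand_bound c (v :: z) a b) -> expand_bound c' z 1 b ->
  expand_bound (c + c') z a.+1 b.
Proof.
move=> zab c'0 IH H1 g f.
pose G v := seqE (v :: z) a (fun x => g (v :: x)).
pose h x := if x is v :: _ then G v / mu (v :: z) else 0.
(* For a null prefix the quotient is 0 by convention, and so is [G v]. *)
have GE v : mu (v :: z) * (G v / mu (v :: z)) = G v.
  have [m0|m0] := eqVneq (mu (v :: z)) 0; last by rewrite mulrC divfK.
  by rewrite m0 mul0r /G seqE_eq0 //=; lia.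
have hE F : seqE z 1 F = \sum_v mu (v :: z) * F [:: v].
  by rewrite seqES; apply: eq_bigr => v _; rewrite /seqE /= cats0.
have mean_h : seqE z 1 h = seqE z a.+1 g.
  by rewrite hE seqES; apply: eq_bigr => v _; rewrite /= GE.
have sqr_h : seqE z 1 (fun x => h x ^+ 2) <= seqE z a.+1 (fun x => g x ^+ 2).
  rewrite hE seqES; apply: ler_sum => v _; rewrite /= expr2 mulrA GE mulrA -expr2.
  by apply: seqE_jensen => /=; lia.
have cross : seqsum 1 (fun x => seqsum b (fun y => mu (z ++ x ++ y) * (h x * f y))) =
    \sum_v G v * seqE (v :: z) b f / mu (v :: z).
  apply: eq_bigr => v _ /=; rewrite mulrAC -seqsumZ; apply: eq_seqsum => y _ /=.
  by rewrite mu_cons_cat mulrCA.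
have -> : seqsum a.+1 (fun x => seqsum b (fun y => mu (z ++ x ++ y) * (g x * f y))) =
    \sum_v seqsum a (fun x => seqsum b (fun y => mu ((v :: z) ++ x ++ y) * (g (v :: x) * f y))).
  apply: eq_bigr => v _; apply: eq_seqsum => x _; apply: eq_seqsum => y _.
  by rewrite cat_cons mu_cons_cat.
(* The summed bounds leave [cross], to which [H1] is applied with [h] in the place of [g]; Jensen's
   inequality [sqr_h] then returns to the square norm of [g]. *)
apply: (le_trans (ler_sum _ (fun v _ => IH v (fun x => g (v :: x)) f))).
rewrite big_split /= -cross -mulr_sumr big_split /=
  -(seqES z a (fun x => g x ^+ 2)) seqE_cons; last by lia.
apply: (le_trans (lerD (H1 h f) (lexx _))); rewrite mean_h -addrA lerD2l.
rewrite [c + c']addrC mulrDl [leRHS]mulrDl lerD2r ler_wpM2l ?divr_ge0 //.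
by rewrite lerD2r.
Qed.

Lemma expand_bound_all lam z a b : 0 <= lam ->
  (forall z', (size z' + 2 <= n)%N -> expand_bound lam z' 1 1) ->
  (size z + a + b <= n)%N -> expand_bound ((a * b)%:R * lam) z a b.
Proof.
move=> lam0 base.
(* By symmetry a [(1, d.+1)] pair is a [(d.+1, 1)] pair; revealing one of its [d.+1] vertices costs
   one [lam]. *)
have one d : forall z', (size z' + 1 + d <= n)%N -> expand_bound (d%:R * lam) z' 1 d.
  elim: d => [|d IHd] z' zd; apply: expand_boundC.
    by rewrite mul0r; apply: expand_bound0; lia.
  rewrite -natr1 mulrDl mul1r; apply: expand_boundS => //; first by lia.
    by move=> v; apply: expand_boundC; apply: IHd => /=; lia.
  by apply: base; lia.
elim: a z => [|a IHa] z zab; first by rewrite mul0r; apply: expand_bound0; lia.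
rewrite mulSnr natrD mulrDl; apply: expand_boundS => //; first by rewrite mulr_ge0.
  by move=> v; apply: IHa => /=; lia.
by apply: one; lia.
Qed.
End Exchangeable.

(** * The base case: the underlying graph of a link *)

Section LinkChain.
Variables (R : rcfType) (V : finType) (n : nat) (mu : seq V -> R).
Hypothesis mu_ge0 : forall x, 0 <= mu x.
Hypothesis mu_perm : forall x y, perm_eq x y -> mu x = mu y.
Hypothesis mu_marg : forall x, (size x < n)%N -> \sum_v mu (v :: x) = mu x.
Variables (z : seq V) (A : {set V}) (lam : R).
Hypotheses (size_z : (size z + 2 <= n)%N) (mu_z : 0 < mu z).
Hypothesis in_A : forall x, (x \in A) = (0 < mu (x :: z)).
Hypothesis mu_xx : forall x, mu [:: x, x & z] = 0.
Hypothesis eigM :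
  eig_but_top_in (\matrix_(i < #|A|, j < #|A|)
    (mu [:: enum_val i, enum_val j & z] / mu (enum_val i :: z))) lam.

Let muC x y : mu [:: x, y & z] = mu [:: y, x & z].
Proof. by apply: mu_perm; rewrite (perm_catCA [:: x] [:: y]). Qed.

Let marg x : \sum_y mu [:: x, y & z] = mu (x :: z).
Proof. by rewrite -mu_marg /=; last lia; apply: eq_bigr => y _; rewrite muC. Qed.

Let notin_A x : x \notin A -> mu (x :: z) = 0.
Proof. by rewrite in_A lt_def mu_ge0 andbT negbK => /eqP. Qed.

Let notin_A2 x y : x \notin A -> mu [:: x, y & z] = 0.
Proof.
move=> /notin_A m0; have := marg x; rewrite m0 => /eqP.
by rewrite psumr_eq0 // => /allP/(_ y (mem_index_enum _))/eqP.
Qed.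

Let sum_A (F : V -> R) : (forall x, x \notin A -> F x = 0) ->
  \sum_x F x = \sum_(i < #|A|) F (enum_val i).
Proof.
move=> F0; rewrite -big_enum_val [RHS]big_mkcond /=.
by apply: eq_bigr => x _; case: ifPn => // /F0.
Qed.

Let K (i j : 'I_#|A|) := mu [:: enum_val i, enum_val j & z].
Let p (i : 'I_#|A|) := mu (enum_val i :: z).

Let p_gt0 i : 0 < p i.
Proof. by rewrite -in_A enum_valP. Qed.

Let K_marg i : \sum_j K i j = p i.
Proof.
rewrite -(sum_A (F := fun y => mu [:: enum_val i, y & z])) ?marg // => x xA.
by rewrite muC notin_A2.
Qed.

(** Positive mass at [z] forces an edge in its link, and [mu_xx] makes the two ends distinct. The
    second vertex is what gives [0 <= lam]. *)
Let card_A : (1 < #|A|)%N.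
Proof.
have pos (F : V -> R) : 0 < \sum_x F x -> exists x, F x > 0.
  move=> F0; apply/existsP; apply: contraLR F0; rewrite negb_exists -leNgt => /forallP F0.
  by apply: sumr_le0 => x _; rewrite leNgt.
have [x px] : exists x, 0 < mu (x :: z) by apply: pos; rewrite mu_marg //; lia.
have [y pxy] : exists y, 0 < mu [:: x, y & z] by apply: pos; rewrite marg.
apply/card_gt1P; exists x, y; split; first by rewrite in_A.
  by apply: contraLR pxy => yA; rewrite muC notin_A2 // ltxx.
by apply: contraTneq pxy => ->; rewrite mu_xx ltxx.
Qed.

Lemma link_lam_ge0 : 0 <= lam.
Proof. by apply: (reversible_chain_lam_ge0 p_gt0 _ eigM) => // i j; exact: muC. Qed.

(** Only vertices in [A] carry mass, so the sums become those of the chain [K] with marginal [p],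
    whose total mass is [mu z]. *)
Lemma link_expand_bound : expand_bound mu lam z 1 1.
Proof.
move=> g f; have mu_rcons x : mu (z ++ [:: x]) = mu (x :: z).
  by apply: mu_perm; rewrite perm_catC.
have mu_rcons2 x y : mu (z ++ [:: x; y]) = mu [:: x, y & z].
  by apply: mu_perm; rewrite perm_catC.
have seqE1 F : seqE mu z 1 F = \sum_i p i * F [:: enum_val i].
  transitivity (\sum_x mu (x :: z) * F [:: x]).
    by apply: eq_bigr => x _; rewrite /= mu_rcons.
  by apply: sum_A => x /notin_A ->; rewrite mul0r.
have sum_p : mu z = \sum_i p i.
  by rewrite -mu_marg; [apply: sum_A => x /notin_A | lia].
have -> : seqsum 1 (fun x => seqsum 1 (fun y => mu (z ++ x ++ y) * (g x * f y))) =
    \sum_i \sum_j K i j * (g [:: enum_val i] * f [:: enum_val j]).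
  transitivity (\sum_x \sum_y mu [:: x, y & z] * (g [:: x] * f [:: y])).
    by apply: eq_bigr => x _; apply: eq_bigr => y _; rewrite /= mu_rcons2.
  rewrite sum_A => [|x xA]; last by apply: big1 => y _; rewrite notin_A2 // mul0r.
  apply: eq_bigr => i _; rewrite sum_A // => y yA.
  by rewrite muC notin_A2 // mul0r.
rewrite !seqE1 sum_p; apply: reversible_chain_bound => //.
- by move=> i j; exact: mu_ge0.
- by move=> i j; exact: muC.
- by rewrite (leq_trans _ card_A).
- exact: link_lam_ge0.
Qed.

End LinkChain.

(** * From sets to orderings: weights of faces and links *)

Lemma seqsum_uniq (R : realFieldType) (V : finType) a (F : {set V} -> R) :
  seqsum a (fun x => if uniq x then F [set y in x] else 0) =
  a`!%:R * \sum_(s : {set V} | #|s| == a) F s.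
Proof.
elim: a F => [|a IHa] F.
  rewrite /= mul1r (big_pred1 set0) => [|s]; last exact: cards_eq0.
  by congr F; apply/setP => y; rewrite !inE.
transitivity (\sum_v a`!%:R *
    \sum_(s : {set V} | #|s| == a) (if v \notin s then F (v |: s) else 0)).
  apply: eq_bigr => v _; rewrite -IHa; apply: eq_seqsum => x _ /=.
  by rewrite inE set_cons; case: (v \in x); case: (uniq x).
rewrite factS mulnC natrM -mulrA -mulr_sumr; congr (_ * _).
(* Adding the head [v] to the set of the tail gives a set [s] marked at [v]; each [s] is counted
   once per element, which supplies the factor [a.+1] of the factorial. *)
transitivity (\sum_v \sum_(s : {set V} | (#|s| == a.+1) && (v \in s)) F s).
  apply: eq_bigr => v _; rewrite -big_mkcondr /=.
  rewrite (reindex_onto (fun s : {set V} => s :\ v) (fun s => v |: s)) /=; last first.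
    by move=> s /andP[_ vs]; rewrite setU1K.
  apply: eq_big => [s|s /andP[_ /eqP ->] //].
  rewrite !inE eqxx /= andbT; apply/andP/andP => [[/eqP sa /eqP vs]|[/eqP sa vs]].
    by rewrite -vs setU11 cardsU1 !inE eqxx /= sa.
  by rewrite setD1K // eqxx; have := cardsD1 v s; rewrite sa vs add1n => -[<-]; rewrite eqxx.
rewrite (exchange_big_dep (fun s : {set V} => #|s| == a.+1)) /=; last by move=> ? ? _ /andP[].
rewrite mulr_sumr; apply: eq_bigr => s /eqP sa.
rewrite (eq_bigl (mem s)) => [|v]; last by rewrite sa eqxx.
by rewrite sumr_const sa mulr_natl.
Qed.

Section Complex.
Variables (R : rcfType) (V : finType) (d : nat) (w : {set V} -> R).
Hypothesis hw : weighted_complex d w.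
Implicit Types (A s t : {set V}) (x y z : seq V).

Let w_ge0 t : 0 <= w t. Proof. by case: hw. Qed.

Lemma wt_ge0 A : 0 <= wt w A.
Proof. exact: sumr_ge0. Qed.

(** Double counting: a top face containing [A] has [d.+1 - #|A|] vertices outside [A]. *)
Lemma sum_wt_setU1 A :
  \sum_(v | v \notin A) wt w (v |: A) = (d.+1 - #|A|)%:R * wt w A.
Proof.
case: hw => _ w_card _; rewrite /wt mulr_sumr.
rewrite (exchange_big_dep (fun t : {set V} => A \subset t)) /=; last first.
  by move=> v t _; rewrite subUset => /andP[].
apply: eq_bigr => t At; have [->|/w_card tE] := eqVneq (w t) 0.
  by rewrite big1 ?mulr0.
rewrite (eq_bigl (mem (t :\: A))) => [|v]; last first.
  by rewrite subUset sub1set At andbT !inE andbC.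
by rewrite sumr_const cardsDS // tE mulr_natl.
Qed.

(* The probability that a uniformly ordered random top face starts with x. *)
Definition face_seq (x : seq V) : R :=
  if uniq x then wt w [set y in x] / (d.+1 ^_ (size x))%:R else 0.

Lemma face_seq_ge0 x : 0 <= face_seq x.
Proof. by rewrite /face_seq; case: ifP => // _; rewrite divr_ge0 ?wt_ge0. Qed.

Lemma face_seq_perm x y : perm_eq x y -> face_seq x = face_seq y.
Proof.
move=> xy; rewrite /face_seq (perm_uniq xy) (perm_size xy).
by congr (if _ then wt w _ / _ else _); apply/setP => v; rewrite !inE (perm_mem xy).
Qed.

Lemma card_set_uniq x : uniq x -> #|[set y in x]| = size x.
Proof. by move=> /card_uniqP <-; rewrite cardsE. Qed.

Lemma face_seq_marg x : (size x < d.+1)%N -> \sum_v face_seq (v :: x) = face_seq x.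
Proof.
move=> xd; rewrite /face_seq /=; case: (boolP (uniq x)) => ux; last first.
  by apply: big1 => v _; rewrite andbF.
transitivity (\sum_(v | v \notin [set y in x])
    wt w (v |: [set y in x]) / (d.+1 ^_ (size x).+1)%:R).
  rewrite [RHS]big_mkcond; apply: eq_bigr => v _.
  by rewrite andbT inE set_cons.
rewrite -mulr_suml sum_wt_setU1 card_set_uniq // ffactnSr natrM; field.
by rewrite !pnatr_eq0 -!lt0n ffact_gt0 subn_gt0 xd ltnW.
Qed.

(** The map from [t] to [t :|: s] is a bijection from the sets disjoint from [s] to those containing
    [s]. *)
Lemma wt_linkw s A :
  wt (linkw w s) A = if [disjoint A & s] then wt w (A :|: s) / wt w s else 0.
Proof.
rewrite /wt /linkw; case: ifPn => As; last first.
  apply: big1 => t At; case: ifPn => // ts; case/negP: As.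
  exact: disjointWl At ts.
rewrite -big_mkcondr -mulr_suml /=; congr (_ / _).
rewrite [RHS](reindex_onto (fun t => t :|: s) (fun t => t :\: s)) /=; last first.
  by move=> t; rewrite subUset => /andP[_ st]; rewrite -[RHS](setID t s) (setIidPr st) setUC.
apply: eq_bigl => t; rewrite subUset subsetUr andbT setDUl setDv setU0.
apply/andP/andP => [[At ts]|[At /eqP ts]].
  by split; [exact: subset_trans At (subsetUl _ _) | apply/eqP/setDidPl].
have ts' : [disjoint t & s] by apply/setDidPl.
split=> //; apply/subsetP => v vA.
have := subsetP At v vA; rewrite inE => /orP[//|vs].
by have := disjointFr As vA; rewrite vs.
Qed.

Lemma disjoint_set_seq x y :
  [disjoint [set v in x] & [set v in y]] = ~~ has (mem x) y.
Proof.
rewrite disjoint_sym (eq_disjoint (B := mem y)) => [|v]; last by rewrite inE.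
by rewrite disjoint_has; congr (~~ _); apply: eq_has => v; rewrite /= inE.
Qed.

Lemma set_seq_cat x y : [set v in x ++ y] = [set v in x] :|: [set v in y].
Proof. by apply/setP => v; rewrite !inE mem_cat. Qed.

(** The link measure is proportional to [face_seq], with a factor that depends only on [z] and [j]
    and hence cancels in the random walk. If [u] meets [z], both sides are 0. *)
Lemma prk_linkw z u j : uniq z -> uniq u -> size u = j.+1 -> (size z + j <= d)%N ->
  prk (d - size z) (linkw w [set v in z]) j [set v in u] =
  (d.+1 ^_ (size z + j.+1))%:R / (wt w [set v in z] * 'C((d - size z).+1, j.+1)%:R)
  * face_seq (u ++ z).
Proof.
move=> uz uu su zj; rewrite /prk /face_seq card_set_uniq // su eqxx wt_linkw.
rewrite disjoint_set_seq cat_uniq uu uz andbT /= set_seq_cat size_cat su [(j.+1 + _)%N]addnC.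
case: ifP => _; last by rewrite mul0r mulr0.
have N0 : (d.+1 ^_ (size z + j.+1))%:R != 0 :> R.
  by rewrite pnatr_eq0 -lt0n ffact_gt0; lia.
by rewrite -[X in X / _ / _ = _](divfK N0) invfM; ring.
Qed.

Lemma face_seq_gt0 z : 0 < face_seq z -> uniq z /\ 0 < wt w [set v in z].
Proof.
rewrite /face_seq; case: ifP => [_ mz|]; last by rewrite ltxx.
split=> //; rewrite lt_def wt_ge0 andbT; apply: contraTneq mz => ->.
by rewrite mul0r ltxx.
Qed.

Lemma face_seq_diag z (x : V) : face_seq [:: x, x & z] = 0.
Proof. by rewrite /face_seq /= inE eqxx. Qed.

Section Link.
Variable z : seq V.
Hypotheses (mu_z : 0 < face_seq z) (size_z : (size z + 2 <= d.+1)%N).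

Let coef_gt0 j : (j <= 1)%N -> 0 < (d.+1 ^_ (size z + j.+1))%:R /
  (wt w [set v in z] * 'C((d - size z).+1, j.+1)%:R).
Proof.
have [_ wz] := face_seq_gt0 mu_z => j1.
by rewrite divr_gt0 ?mulr_gt0 // ltr0n ?ffact_gt0 ?bin_gt0; lia.
Qed.

Lemma in_vtx_link (x : V) :
  (x \in vtx (d - size z) (linkw w [set v in z])) = (0 < face_seq (x :: z)).
Proof.
have [uz _] := face_seq_gt0 mu_z.
rewrite inE; have -> : [set x] = [set v in [:: x]] by apply/setP => y; rewrite !inE.
by rewrite prk_linkw //; [rewrite pmulr_rgt0 // coef_gt0 | lia].
Qed.

Lemma rw_link (x y : V) :
  rw (d - size z) (linkw w [set v in z]) x y =
  face_seq [:: x, y & z] / face_seq (x :: z).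
Proof.
have [uz _] := face_seq_gt0 mu_z.
have edgeE v : x != v -> prk (d - size z) (linkw w [set v in z]) 1 [set x; v] =
    (d.+1 ^_ (size z + 2))%:R / (wt w [set v in z] * 'C((d - size z).+1, 2)%:R)
    * face_seq [:: x, v & z].
  have -> : [set x; v] = [set u in [:: x; v]] by apply/setP => u; rewrite !inE.
  by move=> xv; rewrite prk_linkw //= ?inE ?xv //; lia.
have := coef_gt0 (leqnn 1); set c := (X in 0 < X) => c_gt0.
rewrite /rw; have [<-|xy] := eqVneq x y; first by rewrite face_seq_diag mul0r.
rewrite edgeE // -/c; under eq_bigr => v vx do rewrite edgeE 1?eq_sym // -/c.
have -> : \sum_(v | v != x) c * face_seq [:: x, v & z] = c * face_seq (x :: z).
  rewrite -mulr_sumr -[face_seq (x :: z)]face_seq_marg /=; last by lia.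
  rewrite [in RHS](bigD1 x) //= face_seq_diag add0r; congr (_ * _).
  by apply: eq_bigr => v _; apply: face_seq_perm; rewrite (perm_catCA [:: x] [:: v]).
by rewrite -mulf_div divff ?mul1r // gt_eqF.
Qed.

Lemma eig_link lam : link_expander d w lam ->
  eig_but_top_in (\matrix_(i < #|vtx (d - size z) (linkw w [set v in z])|,
                           j < #|vtx (d - size z) (linkw w [set v in z])|)
    (face_seq [:: enum_val i, enum_val j & z] / face_seq (enum_val i :: z))) lam.
Proof.
have [uz wz] := face_seq_gt0 mu_z => /(_ _ wz).
rewrite card_set_uniq // => /(_ ltac:(lia)).
congr eig_but_top_in; apply/matrixP => i j; rewrite !mxE; exact: rw_link.
Qed.

End Link.

(** * The complement walk as a pair of consecutive segments *)

Lemma sum_cw_edge l1 l2 (H : {set V} -> {set V} -> R) : (l1 + l2 + 1 <= d)%N ->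
  \sum_s \sum_t cw_edge d w l1 l2 s t * H s t =
  seqsum l1.+1 (fun x => seqsum l2.+1 (fun y =>
    face_seq (x ++ y) * H [set v in x] [set v in y])).
Proof.
move=> ld.
(* For orderings [x] of [s] and [y] of [t] this is the summand on the right. It depends on the sets
   alone, so [seqsum_uniq] applies to each of the two sums. *)
pose Q s t := if [disjoint s & t] then wt w (s :|: t) / (d.+1 ^_ (l1 + l2).+2)%:R * H s t
              else 0.
transitivity (seqsum l1.+1 (fun x => if uniq x then
    l2.+1`!%:R * \sum_(t : {set V} | #|t| == l2.+1) Q [set v in x] t else 0)); last first.
  apply: eq_seqsum => x sx; case: ifPn => ux; last first.
    by apply/esym/seqsum_eq0 => y _; rewrite /face_seq cat_uniq (negbTE ux) mul0r.
  rewrite -seqsum_uniq; apply: eq_seqsum => y sy.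
  rewrite /face_seq cat_uniq ux /Q disjoint_set_seq set_seq_cat size_cat sx sy addSn addnS /=.
  by case: (uniq y); rewrite ?andbT ?andbF ?mul0r //; case: ifP; rewrite ?mul0r.
pose F s := l2.+1`!%:R * \sum_(t : {set V} | #|t| == l2.+1) Q s t.
rewrite (seqsum_uniq _ F) mulr_sumr [RHS]big_mkcond /=; apply: eq_bigr => s _.
have [/eqP sl|sl] := ifP; last first.
  by apply: big1 => t _; rewrite /cw_edge sl mul0r.
rewrite /F !mulr_sumr [RHS]big_mkcond /=; apply: eq_bigr => t _.
rewrite /cw_edge sl eqxx /=; have [tl|_] := eqVneq #|t| l2.+1; last by rewrite mul0r.
rewrite /= /Q; case: ifPn => st; last by rewrite mul0r !mulr0.
rewrite /prk cardsU (disjoint_setI0 st) cards0 subn0 sl tl addSn addnS eqxx.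
(* The orderings of [s] and [t] times the choices of [s] in the union give all orderings of the
   union, which turns the binomial weights into falling factorials. *)
have e1 := bin_ffact d.+1 (l1 + l2).+2.
have e2 : ('C((l1 + l2).+2, l1.+1) * (l1.+1`! * l2.+1`!))%N = (l1 + l2).+2`!.
  rewrite -(@bin_fact (l1 + l2).+2 l1.+1); last by lia.
  by congr (_ * (_ * _`!))%N; lia.
have fact_neq0 k : k`!%:R != 0 :> R by rewrite pnatr_eq0 -lt0n fact_gt0.
have bin_neq0 m k : (k <= m)%N -> 'C(m, k)%:R != 0 :> R.
  by rewrite pnatr_eq0 -lt0n bin_gt0.
have := bin_neq0 d.+1 (l1 + l2).+2 ltac:(lia).
have := bin_neq0 (l1 + l2).+2 l1.+1 ltac:(lia).
have := fact_neq0 l1.+1; have := fact_neq0 l2.+1.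
rewrite -e1 -e2; move: (l1.+1)`! (l2.+1)`! 'C(_, (l1 + l2).+2) 'C(_, l1.+1).
by move=> c1 c2 b1 b2 *; rewrite !natrM; field; apply/and4P.
Qed.

End Complex.

Unset Implicit Arguments.

(** * The bound for the complement walk *)

Theorem theorem7p1 (R : rcfType) (V : finType) (d : nat)
    (w : {set V} -> R) (lam : R) (l1 l2 : nat) :
  weighted_complex d w ->
  link_expander d w lam ->
  (l1 + l2 + 1 <= d)%N ->
  bip_lambda_le (cw_edge d w l1 l2) (((l1 + 1) * (l2 + 1))%:R * lam).
Proof.
move=> hw hX ld f g f_mean f_norm g_norm; pose mu := face_seq d w.
have mu_ge0 := face_seq_ge0 hw; have mu_perm := @face_seq_perm _ _ d w.
have mu_marg := face_seq_marg hw.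
have mu_nil : mu [::] = 1.
  rewrite /mu /face_seq /= ffactn0 divr1 /wt -[RHS](let: And3 _ _ w1 := hw in w1).
  by apply: eq_bigl => t; apply/subsetP => v; rewrite inE.
(* Read off from the graph of the whole complex, the link of the empty prefix; [ld] gives
   [1 <= d]. *)
have lam0 : 0 <= lam.
  have mu0 : 0 < mu [::] by rewrite mu_nil.
  have z0 : (size (@nil V) + 2 <= d.+1)%N by rewrite /=; lia.
  exact: (link_lam_ge0 mu_ge0 mu_perm mu_marg z0 mu0 (in_vtx_link hw mu0 z0)
    (face_seq_diag d w [::]) (eig_link hw mu0 z0 hX)).
have base z : (size z + 2 <= d.+1)%N -> expand_bound mu lam z 1 1.
  move=> zd; have [mz|mz] := eqVneq (mu z) 0.
    by apply: (expand_bound_null mu_ge0 mu_perm mu_marg) => //; lia.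
  have mz0 : 0 < mu z by rewrite lt_def mz mu_ge0.
  exact: (link_expand_bound mu_ge0 mu_perm mu_marg zd mz0 (in_vtx_link hw mz0 zd)
    (face_seq_diag d w z) (eig_link hw mz0 zd hX)).
have size_le : (size (@nil V) + l1.+1 + l2.+1 <= d.+1)%N by rewrite /=; lia.
have bound := expand_bound_all mu_ge0 mu_perm mu_marg lam0 base size_le.
pose gs (x : seq V) := g [set v in x]; pose fs (x : seq V) := f [set v in x].
(* The other segment is summed out, so each marginal is the law of a single segment. *)
have sumR (F : {set V} -> R) : \sum_t margR (cw_edge d w l1 l2) t * F t =
    seqE mu [::] l2.+1 (fun y => F [set v in y]).
  transitivity (\sum_s \sum_t cw_edge d w l1 l2 s t * F t).
    by rewrite exchange_big; apply: eq_bigr => t _; rewrite mulr_suml.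
  rewrite (sum_cw_edge _ (fun _ t => F t)) // exchange_seqsum.
  apply: eq_seqsum => y sy; rewrite -(seqsum_mu_cat mu_perm mu_marg (a := l1.+1)) ?sy; last by lia.
  by apply: eq_seqsum => x _; rewrite (mu_perm _ (y ++ x)) // perm_catC.
have sumL (F : {set V} -> R) : \sum_s margL (cw_edge d w l1 l2) s * F s =
    seqE mu [::] l1.+1 (fun x => F [set v in x]).
  transitivity (\sum_s \sum_t cw_edge d w l1 l2 s t * F s).
    by apply: eq_bigr => s _; rewrite mulr_suml.
  rewrite (sum_cw_edge _ (fun s _ => F s)) //.
  apply: eq_seqsum => x sx; apply: (seqsum_mu_cat mu_perm mu_marg); lia.
have P_ge0 s t : 0 <= cw_edge d w l1 l2 s t.
  rewrite /cw_edge /prk; case: ifP => // _; case: ifP => _; last by rewrite mul0r.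
  by rewrite !divr_ge0 // (wt_ge0 hw).
have -> : \sum_s margL (cw_edge d w l1 l2) s * bipB (cw_edge d w l1 l2) f s * g s =
    seqsum l1.+1 (fun x => seqsum l2.+1 (fun y => mu ([::] ++ x ++ y) * (gs x * fs y))).
  rewrite -(sum_cw_edge _ (fun s t => g s * f t)) //; apply: eq_bigr => s _.
  have -> : \sum_t cw_edge d w l1 l2 s t * (g s * f t) =
      (\sum_t cw_edge d w l1 l2 s t * f t) * g s.
    by rewrite mulr_suml; apply: eq_bigr => t _; ring.
  (* Where the marginal is 0 all edge weights at [s] are 0, so the division by 0 in [bipB] is
     harmless. *)
  congr (_ * _); rewrite /bipB; have [m0|m0] := eqVneq (margL (cw_edge d w l1 l2) s) 0.
    rewrite m0 mul0r big1 // => t _; move/eqP: m0; rewrite psumr_eq0 //.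
    by move=> /allP/(_ t (mem_index_enum _))/eqP ->; rewrite mul0r.
  by rewrite mulrC divfK.
(* The mean of [f] is 0, which removes the product of means, and the two unit norms turn [c / 2]
   into [c]. *)
apply: (le_trans (bound gs fs)).
have -> : seqE mu [::] l2.+1 fs = 0 by rewrite -sumR.
have -> : seqE mu [::] l2.+1 (fun y => fs y ^+ 2) = 1.
  by rewrite -(sumR (fun t => f t ^+ 2)).
have -> : seqE mu [::] l1.+1 (fun x => gs x ^+ 2) = 1.
  by rewrite -(sumL (fun s => g s ^+ 2)).
by rewrite mulr0 mul0r add0r !addn1 -[1 + 1]/(2%:R) divfK ?pnatr_eq0.
Qed.
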